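(* Let $T=\begin{pmatrix}a&b\\c&d\end{pmatrix}\in\mathcal{M}_2(\mathbb{C})$. If $W_{uc}(T)=W_c(T)\subseteq[0,\infty)$, then $T$ is the sum of the trace-zero diagonal matrix $\begin{pmatrix}a&0\\0&d\end{pmatrix}-\tau_2(T)I_2$ and the matrix $\begin{pmatrix}\frac{a+d}{2}&b\\c&\frac{a+d}{2}\end{pmatrix}$, which is positive semidefinite. Consequently $p_T\in\mathcal{P}_2$.
   Context: $\mathcal{M}_n(\mathbb{C})$ is the algebra of $n\times n$ complex matrices and $\tau_m=\frac1m\mathrm{Tr}$ denotes the normalized trace on $\mathcal{M}_m(\mathbb{C})$. The correlation numerical range $W_c(A)$ of $A=(\alpha_{ij})\in\mathcal{M}_n(\mathbb{C})$ is defined as follows. Let $\hat A=(\alpha_{ij}I_n)$ be the $n\times n$ block matrix acting on $H=\mathbb{C}^n\oplus\cdots\oplus\mathbb{C}^n$ ($n$ copies), and let $E$ be the set of vectors $\frac{1}{\sqrt n}(e_1,e_2,\dots,e_n)^T\in H$ with $e_1,\dots,e_n\in\mathbb{C}^n$ and $\|e_1\|=\cdots=\|e_n\|=1$. Then $W_c(A)=\{\langle\hat A e,e\rangle: e\in E\}$. Let $\mathcal{F}_n$ be the set of all $n\times n$ matrices of the form $\left(\tau_k(U_j^*U_i)\right)_{i,j=1}^n$, where $k$ is any positive integer and $U_1,\dots,U_n$ are unitary $k\times k$ matrices. With $co$ denoting convex hull, $W_{uc}(T)=\{\tau_n(TB): B\in co\,\mathcal{F}_n\}$ for $T\in\mathcal{M}_n(\mathbb{C})$.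 Let $\mathbb{F}_n$ be the free group on $n$ generators $u_1,\dots,u_n$, and let $\mathcal{A}_n$ be its (complex) group algebra, with the involution $*$ (conjugate-linear, anti-multiplicative) extending $u^*=u^{-1}$ for $u\in\mathbb{F}_n$. For $T=(\alpha_{ij})\in\mathcal{M}_n(\mathbb{C})$ define $p_T=\sum_{i,j=1}^n\alpha_{ij}u_i^*u_j\in\mathcal{A}_n$. Let $\mathcal{P}_n$ be the set of elements of $\mathcal{A}_n$ that can be written in the form $\sum_{j=1}^m q_j^*q_j+\sum_{j=1}^m(f_jg_j-g_jf_j)$ for some $m$ and some $q_j,f_j,g_j\in\mathcal{A}_n$. All of these are used here with $n=2$. *)

(* Defs.v *)
From HB Require Import structures.
From mathcomp Require Import all_boot all_order all_algebra.
From mathcomp Require Import finmap monalg.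
From mathcomp Require Import classical_sets.

Set Implicit Arguments.
Unset Strict Implicit.
Unset Printing Implicit Defensive.

Import Order.TTheory GRing.Theory Num.Theory.

Local Open Scope ring_scope.
Local Open Scope sesquilinear_scope.
Local Open Scope classical_set_scope.

(* In a [numClosedFieldType], [0 <= z] means that z is real and nonnegative;  *)
(* this applies to quadratic forms and to convex coefficients alike.          *)
Section Matrices.
Variable C : numClosedFieldType.

(* [dotmx] is a form on row vectors, linear in its first argument. *)
Definition inner n (x y : 'cV[C]_n) : C := dotmx x^T y^T.

Definition vnorm n (x : 'cV[C]_n) : C := sqrtC (inner x x).

Definition psdmx n (A : 'M[C]_n) : Prop :=
  A \is hermsymmx /\ forall v : 'cV[C]_n, 0 <= inner (A *m v) v.

Definition ntrace n (A : 'M[C]_n) : C := n%:R^-1 * \tr A.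

Definition mx22 (a b c d : C) : 'M[C]_2 :=
  \matrix_(i < 2, j < 2)
    if i == 0 then (if j == 0 then a else b) else (if j == 0 then c else d).

(* The direct sum of n copies of C^n is encoded as the column vectors indexed *)
(* by ['I_(\sum_(i < n) n)], with block decomposition [\mxcol].               *)
Definition hatmx n (A : 'M[C]_n) : 'M[C]_(\sum_(i < n) n, \sum_(j < n) n) :=
  \mxblock_(i < n, j < n) ((A i j)%:M : 'M[C]_n).

Definition corr_vectors n : set 'cV[C]_(\sum_(i < n) n) :=
  [set x | exists2 e : 'I_n -> 'cV[C]_n,
     forall i, vnorm (e i) = 1 &
     x = (sqrtC n%:R)^-1 *: \mxcol_(i < n) e i].

Definition Wc n (A : 'M[C]_n) : set C :=
  [set inner (hatmx A *m x) x | x in @corr_vectors n].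

Definition unitary_corr n : set 'M[C]_n :=
  [set B | exists k : nat, exists U : 'I_n -> 'M[C]_k,
     [/\ (0 < k)%N, forall i, U i \is unitarymx &
         B = \matrix_(i < n, j < n) ntrace ((U j)^t* *m U i)]].

Definition convex_hull (V : lmodType C) (S : set V) : set V :=
  [set x | exists m : nat, exists t : 'I_m -> C, exists s : 'I_m -> V,
     [/\ forall k, 0 <= t k, \sum_(k < m) t k = 1, forall k, S (s k) &
         x = \sum_(k < m) t k *: s k]].

Definition Wuc n (T : 'M[C]_n) : set C :=
  [set ntrace (T *m B) | B in convex_hull (@unitary_corr n)].

End Matrices.

(* The free group on n generators, as the set of reduced words. *)
Section FreeGroup.
Variable n : nat.

(* [(i, false)] stands for [u_i], and [(i, true)] for its inverse. *)
Definition letter : Type := ('I_n * bool)%type.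

Definition linv (x : letter) : letter := (x.1, ~~ x.2).

Definition reduced (w : seq letter) : bool :=
  sorted (fun x y => y != linv x) w.

Record free_group := FreeGroup {
  word :> seq letter;
  word_reduced : reduced word
}.

HB.instance Definition _ := [isSub for word].
HB.instance Definition _ := [Choice of free_group by <:].

Definition push (x : letter) (w : seq letter) : seq letter :=
  if w is y :: w' then (if y == linv x then w' else x :: w) else [:: x].

Lemma linvK : involutive linv.
Proof. by case=> i b; rewrite /linv /= negbK. Qed.

Lemma reduced_push x w : reduced w -> reduced (push x w).
Proof.
case: w => [|y w] //= yw; case: eqVneq => [_|yx]; first exact: path_sorted yw.
by rewrite /= yx.
Qed.

Lemma reduced_foldr u v : reduced v -> reduced (foldr push v u).
Proof. by move=> rv; elim: u => //= x u; apply: reduced_push. Qed.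

Lemma pushK x w : reduced w -> push (linv x) (push x w) = w.
Proof.
case: w => [|y w] /=; first by rewrite linvK eqxx.
case: eqVneq => [->|yx] /=; last by rewrite linvK eqxx.
by case: w => [|z w] //= /andP[/negPf->].
Qed.

Lemma push_foldr x u v :
  reduced v -> foldr push v (push x u) = push x (foldr push v u).
Proof.
case: u => [|y u] rv //=; case: eqVneq => [->|//].
by rewrite -{1}[x]linvK pushK // reduced_foldr.
Qed.

Lemma foldr_push_reduced u : reduced u -> foldr push [::] u = u.
Proof.
elim: u => //= x u IHu xu; rewrite (IHu (path_sorted xu)).
by case: u xu {IHu} => //= y u /andP[/negPf->].
Qed.

Lemma reduced_inv w : reduced w -> reduced (rev (map linv w)).
Proof.
rewrite /reduced rev_sorted sorted_map; apply: sub_sorted => x y /=.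
by apply: contraNneq => ->; rewrite linvK.
Qed.

Lemma foldr_push_revK u v :
  reduced v -> foldr push (foldr push v u) (rev (map linv u)) = v.
Proof.
move=> rv; elim: u => //= x u IHu.
by rewrite rev_cons foldr_rcons pushK ?reduced_foldr.
Qed.

Definition fg_one := @FreeGroup [::] isT.
Definition fg_mul (u v : free_group) : free_group :=
  FreeGroup (reduced_foldr u (word_reduced v)).
Definition fg_inv (u : free_group) : free_group :=
  FreeGroup (reduced_inv (word_reduced u)).

Lemma fg_mulA : associative fg_mul.
Proof.
move=> u v w; apply: val_inj => /=; elim: (word u) => //= x s ->.
by rewrite push_foldr ?word_reduced.
Qed.

Lemma fg_mul1 : left_id fg_one fg_mul.
Proof. by move=> u; apply: val_inj. Qed.

Lemma fg_mulr1 : right_id fg_one fg_mul.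
Proof. by move=> u; apply: val_inj; rewrite /= foldr_push_reduced ?word_reduced. Qed.

Lemma fg_mulV : left_inverse fg_one fg_inv fg_mul.
Proof.
move=> u; apply: val_inj => /=.
by rewrite -{1}(foldr_push_reduced (word_reduced u)) foldr_push_revK.
Qed.

Lemma fg_invK : involutive fg_inv.
Proof.
move=> u; apply: val_inj => /=.
by rewrite map_rev revK -map_comp (eq_map linvK) map_id.
Qed.

Lemma fg_mulrV : right_inverse fg_one fg_inv fg_mul.
Proof. by move=> u; rewrite -{1}[u]fg_invK fg_mulV. Qed.

HB.instance Definition _ :=
  isGroup.Build free_group fg_mulA fg_mul1 fg_mulr1 fg_mulV fg_mulrV.

Definition fg_gen (i : 'I_n) : free_group := @FreeGroup [:: (i, false)] isT.

End FreeGroup.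

(* [{malg K[G]}] is the free K-module on G. Its ring structure in [monalg] is *)
(* restricted to monoids without nontrivial units, hence the convolution      *)
(* product defined here on an alias.                                          *)
Definition group_algebra (K : nzRingType) (G : groupType) : Type := {malg K[G]}.

Section GroupAlgebra.
Variables (K : nzRingType) (G : groupType).
Local Notation A := (group_algebra K G).
Implicit Types (p q r : A) (x y : G).

HB.instance Definition _ := GRing.Lmodule.copy A {malg K[G]}.

Definition ga_of (x : G) : A := << 1 *g x >>.

Definition ga_one : A := ga_of 1%g.

Definition ga_mul p q : A :=
  \sum_(x <- msupp p) \sum_(y <- msupp q) << p@_x * q@_y *g (x * y)%g >>.

Local Open Scope fset_scope.

Lemma ga_mulw (d1 d2 : {fset G}) p q :
  msupp p `<=` d1 -> msupp q `<=` d2 ->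
  ga_mul p q =
    \sum_(x <- d1) \sum_(y <- d2) << p@_x * q@_y *g (x * y)%g >>.
Proof.
move=> le_d1 le_d2; rewrite /ga_mul (big_fset_incl _ le_d1) /=.
  apply/eq_bigr=> x _; apply/big_fset_incl => // y _ /mcoeff_outdom ->.
  by rewrite mulr0 monalgU0.
move=> x _ /mcoeff_outdom px.
by rewrite big1 // => y _; rewrite px mul0r monalgU0.
Qed.

Lemma ga_mul0r : left_zero 0 ga_mul.
Proof. by move=> p; rewrite /ga_mul msupp0 big_seq_fset0. Qed.

Lemma ga_mulr0 : right_zero 0 ga_mul.
Proof.
by move=> p; rewrite /ga_mul big1 // => x _; rewrite msupp0 big_seq_fset0.
Qed.

Lemma ga_mulDl : left_distributive ga_mul +%R.
Proof.
move=> p q r.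
rewrite (ga_mulw (msuppD_le p q) (fsubset_refl (msupp r))).
rewrite (ga_mulw (fsubsetUl (msupp p) (msupp q)) (fsubset_refl (msupp r))).
rewrite (ga_mulw (fsubsetUr (msupp p) (msupp q)) (fsubset_refl (msupp r))).
rewrite -big_split /=; apply/eq_bigr=> x _.
rewrite -big_split /=; apply/eq_bigr=> y _.
by rewrite mcoeffD mulrDl monalgUD.
Qed.

Lemma ga_mulDr : right_distributive ga_mul +%R.
Proof.
move=> r p q.
rewrite (ga_mulw (fsubset_refl (msupp r)) (msuppD_le p q)).
rewrite (ga_mulw (fsubset_refl (msupp r)) (fsubsetUl (msupp p) (msupp q))).
rewrite (ga_mulw (fsubset_refl (msupp r)) (fsubsetUr (msupp p) (msupp q))).
rewrite -big_split /=; apply/eq_bigr=> x _.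
rewrite -big_split /=; apply/eq_bigr=> y _.
by rewrite mcoeffD mulrDr monalgUD.
Qed.

Lemma ga_mulUU (a b : K) x y :
  ga_mul << a *g x >> << b *g y >> = << a * b *g (x * y)%g >>.
Proof.
by rewrite (ga_mulw msuppU_le msuppU_le) !big_seq_fset1 !mcoeffUU.
Qed.

Lemma ga_mul_suml I (s : seq I) (F : I -> A) q :
  ga_mul (\sum_(i <- s) F i) q = \sum_(i <- s) ga_mul (F i) q.
Proof. exact: (big_morph (ga_mul^~ q) (fun p r => ga_mulDl p r q) (ga_mul0r q)). Qed.

Lemma ga_mul_sumr I (s : seq I) (F : I -> A) p :
  ga_mul p (\sum_(i <- s) F i) = \sum_(i <- s) ga_mul p (F i).
Proof. exact: (big_morph (ga_mul p) (ga_mulDr p) (ga_mulr0 p)). Qed.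

Lemma ga_mulA : associative ga_mul.
Proof.
move=> p q r; rewrite [p]monalgE.
rewrite (ga_mul_suml _ _ (ga_mul q r)) (ga_mul_suml _ _ q) (ga_mul_suml _ _ r).
apply: eq_bigr => x _; rewrite [q]monalgE (ga_mul_suml _ _ r).
rewrite !(ga_mul_sumr _ _ << p@_x *g x >>) (ga_mul_suml _ _ r).
apply: eq_bigr => y _; rewrite [r]monalgE ga_mulUU.
rewrite (ga_mul_sumr _ _ << q@_y *g y >>) (ga_mul_sumr _ _ << p@_x *g x >>).
rewrite (ga_mul_sumr _ _ << p@_x * q@_y *g (x * y)%g >>).
by apply: eq_bigr => z _; rewrite !ga_mulUU mulrA mulgA.
Qed.

Lemma ga_mul1r : left_id ga_one ga_mul.
Proof.
move=> p; rewrite [p]monalgE ga_mul_sumr; apply: eq_bigr => x _.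
by rewrite ga_mulUU mul1r mul1g.
Qed.

Lemma ga_mulr1 : right_id ga_one ga_mul.
Proof.
move=> p; rewrite [p]monalgE ga_mul_suml; apply: eq_bigr => x _.
by rewrite ga_mulUU mulr1 mulg1.
Qed.

Lemma ga_one_neq0 : ga_one != 0.
Proof. by rewrite monalgU_eq0 oner_eq0. Qed.

HB.instance Definition _ := GRing.Zmodule_isNzRing.Build A
  ga_mulA ga_mul1r ga_mulr1 ga_mulDl ga_mulDr ga_one_neq0.

Lemma ga_sumE p : p = \sum_(x <- msupp p) (<< p@_x *g x >> : A).
Proof. exact: monalgE. Qed.

Lemma ga_mulE (a b : K) x y :
  (<< a *g x >> : A) * (<< b *g y >> : A) = << a * b *g (x * y)%g >>.
Proof. exact: ga_mulUU. Qed.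

Lemma ga_scaleE (a b : K) x : a *: (<< b *g x >> : A) = << a * b *g x >>.
Proof. by apply/malgP=> y; rewrite mcoeffZ !mcoeffU mulrnAr. Qed.

Lemma ga_scalerAl (a : K) p q : a *: (p * q) = (a *: p) * q.
Proof.
rewrite [p]ga_sumE mulr_suml !scaler_sumr mulr_suml; apply: eq_bigr => x _.
rewrite [q]ga_sumE !mulr_sumr scaler_sumr; apply: eq_bigr => y _.
by rewrite !(ga_mulE, ga_scaleE) mulrA.
Qed.

HB.instance Definition _ := GRing.Lmodule_isLalgebra.Build K A ga_scalerAl.

End GroupAlgebra.

Section GroupStarAlgebra.
Variables (C : numClosedFieldType) (G : groupType).
Local Notation A := (group_algebra C G).
Implicit Types (p q : A).

Definition ga_star p : A := \sum_(x <- msupp p) << (p@_x)^* *g x^-1%g >>.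

Lemma ga_starE p x : (ga_star p)@_x = (p@_(x^-1)%g)^*.
Proof.
rewrite /ga_star raddf_sum /=; case: (msuppP p (x^-1)%g) => xp; last first.
  rewrite conjC0 big1_fset // => y yp _; rewrite mcoeffU.
  by case: eqP xp => // <-; rewrite invgK yp.
rewrite (big_fsetD1 (x^-1)%g) //= mcoeffU invgK eqxx big1_fset ?addr0 // => y.
rewrite in_fsetD1 mcoeffU => /andP[/eqP yx _] _.
by case: eqP => // E; case: yx; rewrite -E invgK.
Qed.

Lemma ga_starD p q : ga_star (p + q) = ga_star p + ga_star q.
Proof. by apply/malgP=> x; rewrite mcoeffD !ga_starE mcoeffD rmorphD. Qed.

Lemma ga_starZ (a : C) p : ga_star (a *: p) = a^* *: ga_star p.
Proof. by apply/malgP=> x; rewrite mcoeffZ !ga_starE mcoeffZ rmorphM. Qed.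

Lemma ga_starK : involutive ga_star.
Proof. by move=> p; apply/malgP=> x; rewrite !ga_starE invgK conjCK. Qed.

Lemma ga_starU (a : C) (x : G) :
  ga_star (<< a *g x >> : A) = << a^* *g x^-1%g >>.
Proof.
apply/malgP=> y; rewrite ga_starE !mcoeffU rmorphMn.
by congr (_ *+ nat_of_bool _); apply/eqP/eqP => [->|<-]; rewrite invgK.
Qed.

Lemma ga_starM p q : ga_star (p * q) = ga_star q * ga_star p.
Proof.
have star0 : ga_star 0 = 0 by rewrite -(scale0r (0 : A)) ga_starZ conjC0 !scale0r.
have star_sum I (s : seq I) (F : I -> A) :
    ga_star (\sum_(i <- s) F i) = \sum_(i <- s) ga_star (F i).
  exact: (big_morph ga_star ga_starD star0).
rewrite [p]ga_sumE [q]ga_sumE mulr_suml (star_sum _ (msupp p)).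
rewrite (star_sum _ (msupp p)) mulr_sumr; apply: eq_bigr => x _.
rewrite mulr_sumr (star_sum _ (msupp q)) (star_sum _ (msupp q)) mulr_suml.
apply: eq_bigr => y _.
by rewrite !(ga_mulE, ga_starU) invgM rmorphM mulrC.
Qed.

End GroupStarAlgebra.

Section FreeGroupAlgebra.
Variables (C : numClosedFieldType) (n : nat).
Local Notation A := (group_algebra C (free_group n)).

Definition gen (i : 'I_n) : A := ga_of C (fg_gen i).

Definition poly_of (T : 'M[C]_n) : A :=
  \sum_(i < n) \sum_(j < n) T i j *: (ga_star (gen i) * gen j).

Definition sos_mod_comm : set A :=
  [set p | exists m : nat, exists q f g : 'I_m -> A,
     p = \sum_(j < m) ga_star (q j) * q j
         + \sum_(j < m) (f j * g j - g j * f j)].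

End FreeGroupAlgebra.

(* Main.v *)
Require Import Defs.
From HB Require Import structures.
From mathcomp Require Import all_boot all_order all_algebra.
From mathcomp Require Import ring.
From mathcomp Require Import classical_sets reals complex.

(* Unit vectors in a common direction give the elements                       *)
(* (a + d + b z + c z^* ) / 2 of [Wc T], for z on the unit circle. They are   *)
(* nonnegative, so c = b^* and, taking b z = - |b|, we get 2 |b| <= a + d.    *)
(* Writing b = |b| w with |w| = 1, the quadratic form of                      *)
(* [[s, b], [b^*, s]] is (s - |b|)(|x|^2 + |y|^2) + |b| |x + w y|^2, and p_T  *)
(* is |b| (u_1 + w u_2)^* (u_1 + w u_2) + (a + d - 2 |b|) 1.                  *)

Set Implicit Arguments.
Unset Strict Implicit.
Unset Printing Implicit Defensive.

Import Order.TTheory GRing.Theory Num.Theory.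

Local Open Scope ring_scope.
Local Open Scope sesquilinear_scope.
Local Open Scope classical_set_scope.

(** Everything rests on the pair c = b^*, 2 |b| <= a + d, extracted from positivity of [Wc T] in
    [Wc_mx22_ge0]. One completion of the square then serves twice: for scalars in [psdmx_mx22], and
    in the group algebra in [sum_of_two_squares]. In p_T the relations u_i^* u_i = 1 merge the
    diagonal entries into the scalar a + d, which is why a and d may be averaged. *)

Section Auxiliary.
Variable C : numClosedFieldType.

Lemma innerE n (x y : 'cV[C]_n) : inner x y = \sum_i x i 0 * (y i 0)^*.
Proof. by rewrite /inner dotmxE !mxE; apply: eq_bigr => i _; rewrite !mxE. Qed.

Lemma innerZ n (k l : C) (x y : 'cV[C]_n) :
  inner (k *: x) (l *: y) = k * l^* * inner x y.
Proof.
rewrite !innerE mulr_sumr; apply: eq_bigr => i _.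
by rewrite !mxE rmorphM mulrACA.
Qed.

Lemma inner_mxcol n (x y : 'I_n -> 'cV[C]_n) :
  inner (\mxcol_i x i) (\mxcol_i y i) = \sum_i inner (x i) (y i).
Proof.
have conj_mxcol : (\mxcol_i y i)^T^t* = \mxcol_i (y i)^T^t*.
  by apply/matrixP => i j; rewrite !mxE.
rewrite /inner dotmxE conj_mxcol tr_mxcol mul_mxrow_mxcol summxE.
by apply: eq_bigr => i _; rewrite dotmxE.
Qed.

Lemma hatmx_mxcol n (A : 'M[C]_n) (e : 'I_n -> 'cV[C]_n) :
  hatmx A *m (\mxcol_i e i) = \mxcol_i (\sum_j A i j *: e j).
Proof.
rewrite /hatmx mxblockEv mxcol_mul; apply: eq_mxcol => i.
by rewrite mul_mxrow_mxcol; apply: eq_bigr => j _; rewrite mul_scalar_mx.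
Qed.

(** Polar form; at b = 0 the phase is arbitrary and is set to 1. *)
Lemma unit_factor (b : C) : exists2 w, `|w| = 1 & b = `|b| * w.
Proof.
have [->|b0] := eqVneq b 0; first by exists 1; rewrite ?normr1 // normr0 mul0r.
exists (b / `|b|); first by rewrite normf_div normr_id divff ?normr_eq0.
by rewrite mulrC divfK ?normr_eq0.
Qed.

Lemma hermsymmx_mx22 (a b : C) : a \is Num.real -> mx22 a b b^* a \is hermsymmx.
Proof.
move=> ra; rewrite qualifE /=; apply/eqP; rewrite expr0 scale1r.
apply/matrixP => i j; rewrite !mxE.
by case: i => [[|[|?]] ?] //; case: j => [[|[|?]] ?] //=;
  rewrite ?(CrealP ra) ?conjCK.
Qed.

(** The quadratic form of [hatmx A] sees the vectors [e i] through their Gram matrix. *)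
Lemma Wc_mem n (A : 'M[C]_n) (e : 'I_n -> 'cV[C]_n) :
  (forall i, vnorm (e i) = 1) ->
  Wc A (n%:R^-1 * \sum_i \sum_j A i j * inner (e j) (e i)).
Proof.
move=> e1; exists ((sqrtC n%:R)^-1 *: \mxcol_i e i); first by exists e.
have sn : (sqrtC n%:R)^-1 * ((sqrtC n%:R)^-1)^* = n%:R^-1 :> C.
  rewrite geC0_conj ?invr_ge0 ?sqrtC_ge0 ?ler0n //.
  by rewrite -invfM -expr2 sqrtCK.
rewrite -scalemxAr hatmx_mxcol innerZ sn inner_mxcol; congr (_ * _).
apply: eq_bigr => i _.
rewrite innerE (eq_bigr (fun k => \sum_j A i j * (e j k 0 * (e i k 0)^*))).
  by rewrite exchange_big; apply: eq_bigr => j _; rewrite innerE mulr_sumr.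
move=> k _; rewrite summxE mulr_suml; apply: eq_bigr => j _.
by rewrite mxE mulrA.
Qed.

(** Taking the vectors u and z u, for one unit vector u, gives a Gram matrix with diagonal 1 and
    off-diagonal entries z and z^*. *)
Lemma Wc_mx22_mem (a b c d z : C) : `|z| = 1 ->
  Wc (mx22 a b c d) (2^-1 * (a + d + (b * z + c * z^*))).
Proof.
move=> z1; pose u : 'cV[C]_2 := delta_mx 0 0.
have uu : inner u u = 1.
  rewrite innerE !big_ord_recl big_ord0 !mxE /= conjC1 conjC0.
  by rewrite mulr1 mulr0 !addr0.
pose e (i : 'I_2) := (if i == 0 then 1 else z) *: u.
have innere i j : inner (e j) (e i) =
    (if j == 0 then 1 else z) * (if i == 0 then 1 else z)^*.
  by rewrite innerZ uu mulr1.
have zz : z * z^* = 1 by rewrite -normCK z1 expr1n.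
have e1 i : vnorm (e i) = 1.
  rewrite /vnorm innere; case: ifP => _; last by rewrite zz sqrtC1.
  by rewrite conjC1 mulr1 sqrtC1.
have := Wc_mem (mx22 a b c d) e1.
rewrite !big_ord_recl !big_ord0 !innere !mxE /= conjC1 zz !mulr1 !mul1r !addr0.
by congr (Wc _ (_ * _)); ring.
Qed.

Lemma Wc_mx22_ge0 (a b c d : C) : Wc (mx22 a b c d) `<=` [set z : C | 0 <= z] ->
  c = b^* /\ 2 * `|b| <= a + d.
Proof.
move=> W0.
have H z : `|z| = 1 -> 0 <= a + d + (b * z + c * z^*).
  move=> /(Wc_mx22_mem a b c d)/W0 /=.
  by rewrite pmulr_rge0 ?invr_gt0 ?ltr0n.
have Hr z : `|z| = 1 -> (b * z + c * z^*)^* = b * z + c * z^*.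
  move=> z1; apply: CrealP.
  (* Subtracting the values at z and -z cancels a + d and leaves a real number. *)
  have -> : b * z + c * z^* =
    ((a + d + (b * z + c * z^*)) - (a + d + (b * (- z) + c * (- z)^*))) / 2.
    by rewrite rmorphN; field.
  by rewrite rpredM ?rpredB ?rpredV ?ger0_real ?H ?normrN ?ler0n.
have cb : c = b^*.
  (* Reality at z = 1 and z = i says that b + c and i (b - c) are real; together they give c =
     b^*. *)
  have := Hr 1 (normr1 _); rewrite conjC1 !mulr1 rmorphD => h1.
  have := Hr 'i (normCi _).
  rewrite rmorphD !rmorphM /= conjCi rmorphN /= conjCi opprK => hi.
  have hi' : - b^* + c^* = b - c.
    by apply: (mulIf (neq0Ci C)); rewrite mulrDl mulrBl mulNr -!mulrN.
  apply: (mulfI (_ : 2 != 0)); first by rewrite pnatr_eq0.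
  have -> : 2 * c = (b + c) - (b - c) by ring.
  by rewrite -h1 -hi'; ring.
split=> //; have [w w1 bw] := unit_factor b.
(* This z makes b z = - |b|, the minimum of the real part of b z on the unit circle. *)
have := H (- w^*); rewrite normrN norm_conjC => /(_ w1).
have ww : w * w^* = 1 by rewrite -normCK w1 expr1n.
rewrite (_ : _ + _ = a + d - 2 * `|b|) ?subr_ge0 //.
rewrite cb {1 2}bw rmorphM rmorphN /= conj_normC conjCK.
by ring: ww.
Qed.

Lemma psdmx_mx22 (s b : C) : `|b| <= s -> psdmx (mx22 s b b^* s).
Proof.
move=> bs; have s0 := le_trans (normr_ge0 b) bs.
split=> [|v]; first exact/hermsymmx_mx22/ger0_real.
have [w w1 bw] := unit_factor b.
have ww : w * w^* = 1 by rewrite -normCK w1 expr1n.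
rewrite innerE !big_ord_recl big_ord0 !mxE !big_ord_recl !big_ord0 !mxE /=.
set x := v _ _; set y := v _ _.
have nb : `|b|^* = `|b| by rewrite conj_normC.
set f := (X in 0 <= X).
have -> : f = (s - `|b|) * (`|x| ^+ 2 + `|y| ^+ 2) + `|b| * `|x + w * y| ^+ 2.
  rewrite /f !normCK !rmorphD rmorphM {1 2}bw !rmorphM /= nb.
  by ring: ww.
apply: addr_ge0; last by rewrite mulr_ge0 ?exprn_ge0.
by apply: mulr_ge0; rewrite ?subr_ge0 // addr_ge0 ?exprn_ge0.
Qed.

Lemma sum_ord2 (V : nmodType) (F : 'I_2 -> V) : \sum_(i < 2) F i = F 0 + F 1.
Proof. by rewrite big_ord_recl big_ord1; congr (_ + F _); apply: val_inj. Qed.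

Lemma sum_mx22 (V : lmodType C) (a b c d : C) (F : 'I_2 -> 'I_2 -> V) :
  \sum_(i < 2) \sum_(j < 2) mx22 a b c d i j *: F i j =
    a *: F 0 0 + d *: F 1 1 + b *: F 0 1 + c *: F 1 0.
Proof.
rewrite !sum_ord2 !mxE /= -!addrA; congr (_ + _).
by rewrite [RHS]addrC -addrA.
Qed.

(** Used with e = 1, p = x^* y, q = y^* x and k = |b|: the square absorbs 2 k of the diagonal weight
    s + t, and the rest multiplies e. *)
Lemma scaler_split (V : lmodType C) (e p q : V) (s t k w1 w2 : C) :
  s *: e + t *: e + (k * w1) *: p + (k * w2) *: q =
    k *: (2 *: e + w1 *: p + w2 *: q) + (s + t - 2 * k) *: e.
Proof.
rewrite !scalerDr !scalerA [RHS]addrAC; congr (_ + _).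
rewrite [RHS]addrAC; congr (_ + _); rewrite -!scalerDl; congr (_ *: _).
by ring.
Qed.

(** The involution reverses products, so this is the left-hand rule [scalerAl] after applying
    [ga_star]. *)
Lemma ga_scalerAr (G : groupType) (k : C) (p q : group_algebra C G) :
  k *: (p * q) = p * (k *: q).
Proof.
apply: (can_inj (@ga_starK C G)).
by rewrite ga_starZ !ga_starM ga_starZ -scalerAl.
Qed.

Lemma ga_star1 (G : groupType) : ga_star (1 : group_algebra C G) = 1.
Proof. by rewrite [LHS]ga_starU conjC1 invg1. Qed.

Section IsometricPair.
Variables (G : groupType) (x y : group_algebra C G).
Hypotheses (xK : ga_star x * x = 1) (yK : ga_star y * y = 1).

Lemma ga_star_mulD (r w : C) : `|w| = 1 ->
  let q := r *: (x + w *: y) in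
  ga_star q * q =
    `|r| ^+ 2 *: (2%:A + w *: (ga_star x * y) + w^* *: (ga_star y * x)).
Proof.
move=> w1 /=; rewrite ga_starZ ga_starD ga_starZ.
rewrite -scalerAl -ga_scalerAr scalerA mulrC -normCK; congr (_ *: _).
rewrite mulrDl !mulrDr -!scalerAl -!ga_scalerAr xK yK scalerA.
rewrite mulrC -normCK w1 expr1n -[2]/(1 + 1) scalerDl !scale1r.
by rewrite [w^* *: _ + 1]addrC addrACA addrA.
Qed.

Lemma sum_of_two_squares (a b d : C) : 2 * `|b| <= a + d ->
  exists q1 q2 : group_algebra C G,
    a *: (ga_star x * x) + d *: (ga_star y * y) + b *: (ga_star x * y)
      + b^* *: (ga_star y * x) = ga_star q1 * q1 + ga_star q2 * q2.
Proof.
rewrite -subr_ge0 => t0; have [w w1 bw] := unit_factor b.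
(* Square roots of the two nonnegative weights, so that they can be moved inside the squares. *)
pose r := sqrtC `|b|; pose t := sqrtC (a + d - 2 * `|b|).
have r2 : `|r| ^+ 2 = `|b| by rewrite ger0_norm ?sqrtC_ge0 // sqrtCK.
have t2 : t^* * t = a + d - 2 * `|b|.
  by rewrite geC0_conj ?sqrtC_ge0 // -expr2 sqrtCK.
have tK : ga_star t%:A * t%:A = (a + d - 2 * `|b|)%:A :> group_algebra C G.
  by rewrite ga_starZ ga_star1 -scalerAl -ga_scalerAr mulr1 scalerA t2.
have bcw : b^* = `|b| * w^* by rewrite {1}bw rmorphM /= conj_normC.
exists (r *: (x + w *: y)), t%:A.
rewrite tK (ga_star_mulD r w1) r2 xK yK bcw {1}bw.
exact: scaler_split.
Qed.

End IsometricPair.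

Lemma sos_mod_comm_mx22 (a b d : C) : 2 * `|b| <= a + d ->
  sos_mod_comm (poly_of (mx22 a b b^* d)).
Proof.
have genK (i : 'I_2) : ga_star (gen C i) * gen C i = 1.
  by rewrite ga_starU ga_mulE mulVg conjC1 mulr1.
move=> /(sum_of_two_squares (genK 0) (genK 1))[q1 [q2 q12]].
(* The identity [q12] is exact in the algebra, so all commutators are taken to be zero. *)
exists 2, (fun i => if i == 0 then q1 else q2), (fun=> 0), (fun=> 0).
rewrite [X in _ = _ + X]big1 => [|i _]; last by rewrite subrr.
by rewrite /poly_of sum_mx22 q12 sum_ord2 addr0.
Qed.

End Auxiliary.

Local Open Scope complex_scope.
Local Open Scope classical_set_scope.

Theorem corollary11 (R : realType) (a b c d : R[i]) :
  let T : 'M[R[i]]_2 := mx22 a b c d in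
  let D : 'M[R[i]]_2 := mx22 a 0 0 d - (ntrace T)%:M in
  let M : 'M[R[i]]_2 := mx22 ((a + d) / 2) b c ((a + d) / 2) in
  Wuc T = Wc T -> Wc T `<=` [set z : R[i] | 0 <= z] ->
  [/\ T = D + M, is_diag_mx D, \tr D = 0 & psdmx M]
  /\ sos_mod_comm (poly_of T).
Proof.
move=> T D M _ /Wc_mx22_ge0[cb bad].
have trT : ntrace T = (a + d) / 2.
  by rewrite /ntrace /mxtrace big_ord_recl big_ord1 !mxE mulrC.
split; last by rewrite /T cb; apply: sos_mod_comm_mx22.
split.
- apply/matrixP => i j; rewrite /D trT !mxE.
  by case: i => [[|[|?]] ?] //; case: j => [[|[|?]] ?] //=;
    rewrite ?mulr1n ?mulr0n ?subrK // subr0 add0r.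
- apply/is_diag_mxP => i j; rewrite !mxE.
  by case: i => [[|[|?]] ?] //; case: j => [[|[|?]] ?] //= _;
    rewrite mulr0n subr0.
- rewrite /D trT /mxtrace big_ord_recl big_ord1 !mxE /= !mulr1n.
  by field.
- by rewrite /M cb; apply: psdmx_mx22; rewrite ler_pdivlMr ?ltr0n // mulrC.
Qed.
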